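(* Let $g=tat^{-1}a\in BS(2,3)=\langle a,t\mid ta^2t^{-1}=a^3\rangle$ and let $T$ be the Bass--Serre tree associated to the splitting of $BS(2,3)$ as an HNN extension $\langle a\rangle *_{\langle ta^2t^{-1}=a^3\rangle}$ with base group $\langle a\rangle$ and stable letter $t$. Then $g$ is well-aligned (with respect to the action on $T$) and $\operatorname{scl}(g)=1/12$. In particular, the constant $1/12$ in the statement ''for every group $G$ acting without inversions on a simplicial tree and every well-aligned $g\in G$, $\operatorname{scl}(g)\ge 1/12$'' is optimal, i.e. cannot be replaced by a larger constant.
   Context: For a group $G$ acting without inversions on a simplicial tree $T$ and $g\in G$, let $|g|=\min_{x\in T}d(x,gx)$ (edges have length one). $g$ is hyperbolic if $|g|>0$; then the set $T_g$ of points attaining the minimum is a line, the axis of $g$. A hyperbolic element $g\in G$ is well-aligned if there does not exist $h\in G$ such that $ghgh^{-1}$ fixes an edge of $T_g$. Stable commutator length in a group $G$: for $g\in[G,G]$, $\operatorname{scl}(g)=\lim_{n\to\infty}\operatorname{cl}(g^n)/n$, where $\operatorname{cl}$ is the least number of commutators whose product is the given element; if $g^k\in[G,G]$ for some $k\ge1$, $\operatorname{scl}(g)=\operatorname{scl}(g^k)/k$; otherwise $\operatorname{scl}(g)=\infty$. *)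

(* Defs.v *)
From HB Require Import structures.
From mathcomp Require Import all_boot all_order all_algebra.
From mathcomp Require Import boolp classical_sets reals ereal topology normedtype.

Set Implicit Arguments.
Unset Strict Implicit.
Unset Printing Implicit Defensive.

Import Order.TTheory GRing.Theory Num.Theory.
Import numFieldNormedType.Exports.

Local Open Scope classical_set_scope.
Local Open Scope group_scope.

(* The junk value when no natural number satisfies P is 0. *)
Definition least (P : nat -> Prop) : nat :=
  match pselect (exists n, `[< P n >]) with
  | left h => ex_minn h
  | right _ => 0%N
  end.

(* Every geometric edge is represented by a pair of opposite oriented edges. *)
Record graph : Type := Graph {
  vert : Type;
  edge : Type;
  src : edge -> vert;
  tgt : edge -> vert;
  rev_edge : edge -> edge;
  rev_edgeK : involutive rev_edge;
  rev_edge_neq : forall e, rev_edge e <> e;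
  src_rev : forall e, src (rev_edge e) = tgt e
}.

Section Graphs.
Variable X : graph.

Fixpoint walk (x : vert X) (s : seq (edge X)) (y : vert X) : Prop :=
  match s with
  | [::] => x = y
  | e :: s' => src e = x /\ walk (tgt e) s' y
  end.

Definition reduced (s : seq (edge X)) : Prop :=
  forall s1 e s2, s <> s1 ++ [:: e, rev_edge e & s2].

Definition is_tree : Prop :=
  [/\ exists x : vert X, True,
      forall x y, exists s, walk x s y
    & forall x s, walk x s x -> reduced s -> s = [::]].

Definition dist (x y : vert X) : nat :=
  least (fun n => exists s, walk x s y /\ size s = n).

End Graphs.

Record graph_action (G : groupType) (X : graph) : Type := GraphAction {
  actv : G -> vert X -> vert X;
  acte : G -> edge X -> edge X;
  actv1 : forall x, actv 1 x = x;
  actvM : forall g h x, actv (g * h) x = actv g (actv h x);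
  acte1 : forall e, acte 1 e = e;
  acteM : forall g h e, acte (g * h) e = acte g (acte h e);
  src_act : forall g e, src (acte g e) = actv g (src e);
  rev_act : forall g e, rev_edge (acte g e) = acte g (rev_edge e)
}.

Section Actions.
Variables (G : groupType) (X : graph) (act : graph_action G X).

Definition without_inversions : Prop :=
  forall g e, acte act g e <> rev_edge e.

(* For an action without inversions on a tree, the minimal displacement over
   all points of the tree is attained at a vertex, and an edge consists of
   points of minimal displacement iff both its endpoints do; hence it is enough
   to let points range over the vertices. *)
Definition translation_length (g : G) : nat :=
  least (fun n => exists x, dist x (actv act g x) = n).

Definition hyperbolic (g : G) : Prop := (0 < translation_length g)%N.

Definition axis (g : G) : set (vert X) :=
  [set x | dist x (actv act g x) = translation_length g].

Definition axis_edge (g : G) : set (edge X) :=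
  [set e | axis g (src e) /\ axis g (tgt e)].

Definition well_aligned (g : G) : Prop :=
  hyperbolic g /\
  ~ exists h : G, exists2 e, axis_edge g e & acte act (g * h * g * h^-1) e = e.

End Actions.

Section Scl.
Variable G : groupType.

Definition prod_comm (n : nat) (g : G) : Prop :=
  exists2 s : seq (G * G), size s = n & g = \prod_(p <- s) [~ p.1, p.2].

Definition derived : set G := [set g | exists n, prod_comm n g].

Definition cl (g : G) : nat := least (fun n => prod_comm n g).

Definition scl_derived (R : realType) (g : G) : R :=
  lim ((fun n : nat => (cl (g ^+ n))%:R / n%:R : R)%R @ \oo).

(* The least k >= 1 with g ^+ k in [G, G] is used when there is one, in
   particular k = 1 when g is in [G, G]. *)
Definition scl (R : realType) (g : G) : \bar R :=
  if `[< exists2 k, (0 < k)%N & derived (g ^+ k) >] then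
    let k := least (fun k => (0 < k)%N /\ derived (g ^+ k)) in
    (scl_derived R (g ^+ k)%g / k%:R)%R%:E
  else +oo%E.

End Scl.

Section Presentation.
Variables (X : choiceType).

(* (x, false) is the generator x and (x, true) its formal inverse. *)
Definition word : Type := seq (X * bool).

Definition inv_letter (l : X * bool) : X * bool := (l.1, ~~ l.2).

Definition inv_word (w : word) : word := rev (map inv_letter w).

Variable rel_word : word -> word -> Prop.

Inductive word_eq : word -> word -> Prop :=
| WordRefl w : word_eq w w
| WordSym w1 w2 : word_eq w1 w2 -> word_eq w2 w1
| WordTrans w1 w2 w3 : word_eq w1 w2 -> word_eq w2 w3 -> word_eq w1 w3
| WordCancel u l v : word_eq (u ++ [:: l, inv_letter l & v]) (u ++ v)
| WordRel u r s v : rel_word r s -> word_eq (u ++ r ++ v) (u ++ s ++ v).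

Lemma word_eq_catl u w1 w2 : word_eq w1 w2 -> word_eq (u ++ w1) (u ++ w2).
Proof.
elim=> {w1 w2} [w|w1 w2 _|w1 w2 w3 _ h1 _|u' l v|u' r s v h].
- exact: WordRefl.
- exact: WordSym.
- exact: WordTrans h1.
- by rewrite !catA -[(u ++ u') ++ _ :: _]catA catA; exact: WordCancel.
- by rewrite !(catA u); exact: WordRel.
Qed.

Lemma word_eq_catr v w1 w2 : word_eq w1 w2 -> word_eq (w1 ++ v) (w2 ++ v).
Proof.
elim=> {w1 w2} [w|w1 w2 _|w1 w2 w3 _ h1 _|u l v'|u r s v' h].
- exact: WordRefl.
- exact: WordSym.
- exact: WordTrans h1.
- by rewrite -!catA; exact: WordCancel.
- by rewrite -!catA; exact: WordRel.
Qed.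

Lemma word_eq_cat u1 u2 w1 w2 :
  word_eq u1 u2 -> word_eq w1 w2 -> word_eq (u1 ++ w1) (u2 ++ w2).
Proof.
move=> h1 h2; apply: WordTrans (word_eq_catr _ h1) _.
exact: word_eq_catl.
Qed.

Lemma inv_letterK : involutive inv_letter.
Proof. by case=> x b; rewrite /inv_letter /= negbK. Qed.

Lemma inv_wordK : involutive inv_word.
Proof.
by move=> w; rewrite /inv_word map_rev revK -map_comp map_id_in // => l _;
   rewrite /= inv_letterK.
Qed.

Lemma inv_word_cat u v : inv_word (u ++ v) = inv_word v ++ inv_word u.
Proof. by rewrite /inv_word map_cat rev_cat. Qed.

Lemma word_eq_catV w : word_eq (w ++ inv_word w) [::].
Proof.
elim: w => [|l w IH]; first exact: WordRefl.
rewrite -cat1s inv_word_cat -catA (catA w).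
apply: WordTrans (word_eq_catl _ (word_eq_catr _ IH)) _ => /=.
exact: (WordCancel [::] l [::]).
Qed.

Lemma word_eq_Vcat w : word_eq (inv_word w ++ w) [::].
Proof. by rewrite -{2}[w]inv_wordK; exact: word_eq_catV. Qed.

Lemma word_eq_inv w1 w2 : word_eq w1 w2 -> word_eq (inv_word w1) (inv_word w2).
Proof.
move=> h; set v1 := inv_word w1; set v2 := inv_word w2.
have h1 : word_eq v1 (v1 ++ (w2 ++ v2)).
  rewrite -{1}[v1]cats0; apply: word_eq_catl; apply: WordSym.
  exact: word_eq_catV.
apply: WordTrans h1 _; rewrite catA -{2}[v2]cat0s; apply: word_eq_catr.
apply: WordTrans (word_eq_catl _ (WordSym h)) _.
exact: word_eq_Vcat.
Qed.

Definition word_eqb (w1 w2 : word) : bool := `[< word_eq w1 w2 >].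

Lemma word_eqb_refl : reflexive word_eqb.
Proof. by move=> w; apply/asboolP; exact: WordRefl. Qed.

Lemma word_eqb_sym : symmetric word_eqb.
Proof. by move=> w1 w2; apply/asboolP/asboolP => h; exact: WordSym. Qed.

Lemma word_eqb_trans : transitive word_eqb.
Proof.
by move=> w2 w1 w3 /asboolP h1 /asboolP h2; apply/asboolP; exact: WordTrans h2.
Qed.

Canonical word_equiv :=
  EquivRel word_eqb word_eqb_refl word_eqb_sym word_eqb_trans.

Definition presented : Type := {eq_quot word_equiv}%qT.

HB.instance Definition _ := Choice.on presented.

Definition class_of (w : word) : presented := \pi_({eq_quot word_equiv})%qT w.

Lemma class_ofP w1 w2 : class_of w1 = class_of w2 <-> word_eq w1 w2.
Proof. by split=> [/eqmodP/asboolP|h]; last exact/eqmodP/asboolP. Qed.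

Definition word_of (x : presented) : word :=
  repr (x : {eq_quot word_equiv}%qT).

Lemma word_ofK x : class_of (word_of x) = x.
Proof. exact: reprK. Qed.

Definition pres_mul (x y : presented) : presented :=
  class_of (word_of x ++ word_of y).
Definition pres_inv (x : presented) : presented :=
  class_of (inv_word (word_of x)).
Definition pres_one : presented := class_of [::].

Lemma class_of_cat w1 w2 :
  class_of (w1 ++ w2) = pres_mul (class_of w1) (class_of w2).
Proof.
by apply/class_ofP; apply: word_eq_cat; apply/class_ofP; rewrite word_ofK.
Qed.

Lemma class_of_inv w : class_of (inv_word w) = pres_inv (class_of w).
Proof.
by apply/class_ofP; apply: word_eq_inv; apply/class_ofP; rewrite word_ofK.
Qed.

Lemma pres_mulA : associative pres_mul.
Proof.
move=> x y z; rewrite -[x]word_ofK -[y]word_ofK -[z]word_ofK.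
by rewrite -!class_of_cat catA.
Qed.

Lemma pres_mul1 : left_id pres_one pres_mul.
Proof. by move=> x; rewrite -[x]word_ofK -class_of_cat. Qed.

Lemma pres_mulr1 : right_id pres_one pres_mul.
Proof. by move=> x; rewrite -[x]word_ofK -class_of_cat cats0. Qed.

Lemma pres_mulV : left_inverse pres_one pres_inv pres_mul.
Proof.
move=> x; rewrite -[x]word_ofK -class_of_inv -class_of_cat.
by apply/class_ofP; exact: word_eq_Vcat.
Qed.

Lemma pres_mulrV : right_inverse pres_one pres_inv pres_mul.
Proof.
move=> x; rewrite -[x]word_ofK -class_of_inv -class_of_cat.
by apply/class_ofP; exact: word_eq_catV.
Qed.

HB.instance Definition _ := isGroup.Build presented
  pres_mulA pres_mul1 pres_mulr1 pres_mulV pres_mulrV.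

Definition pres_gen (x : X) : presented := class_of [:: (x, false)].

End Presentation.

Section Subgroups.
Variable G : groupType.

Definition subgroup (H : set G) : Prop :=
  [/\ H 1, forall x y, H x -> H y -> H (x * y) & forall x, H x -> H x^-1].

Definition cyclic_subgroup (x : G) : set G :=
  [set y | exists k : nat, y = x ^+ k \/ y = x ^- k].

Lemma subgroup_cyclic x : subgroup (cyclic_subgroup x).
Proof.
have mixed k l : cyclic_subgroup x (x ^+ k * x ^- l).
  case: (leqP l k) => [h|/ltnW h].
  - by exists (k - l)%N; left; rewrite -{1}(subnK h) expgnDr mulgK.
  - exists (l - k)%N; right.
    by rewrite -{1}(subnK h) expgnDr invgM mulgA mulgV mul1g.
have comm k l : x ^- l * x ^+ k = x ^+ k * x ^- l.
  have c : commute (x ^+ k) (x ^+ l) by rewrite /commute -!expgnDr addnC.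
  by apply: (mulgI (x ^+ l)); rewrite !mulgA mulgV mul1g -c mulgK.
split.
- by exists 0%N; left.
- move=> _ _ [k [->|->]] [l [->|->]].
  + by exists (k + l)%N; left; rewrite expgnDr.
  + exact: mixed.
  + by rewrite comm; exact: mixed.
  + by exists (l + k)%N; right; rewrite expgnDr invgM.
- by move=> _ [k [->|->]]; exists k; [right | left; rewrite invgK].
Qed.

Definition lcoset (g : G) (S : set G) : set G := [set g * x | x in S].

Definition coset_space (H : set G) : Type := {S : set G | exists g, S = lcoset g H}.

Lemma lcosetM g h (S : set G) : lcoset g (lcoset h S) = lcoset (g * h) S.
Proof.
apply/seteqP; split=> [_ [_ [x Sx <-] <-]|_ [x Sx <-]].
  by exists x => //; rewrite mulgA.
by exists (h * x); [exists x|rewrite mulgA].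
Qed.

Lemma lcoset1 (S : set G) : lcoset 1 S = S.
Proof.
apply/seteqP; split=> [_ [x Sx <-]|x Sx]; first by rewrite mul1g.
by exists x => //; rewrite mul1g.
Qed.

Lemma coset_space_inj (H : set G) (S1 S2 : coset_space H) :
  sval S1 = sval S2 -> S1 = S2.
Proof.
by case: S1 S2 => [x px] [y py] /= exy; case: y / exy py => py;
   congr exist; exact: Prop_irrelevance.
Qed.

Lemma translate_subproof (H : set G) (g : G) (S : coset_space H) :
  exists h, lcoset g (sval S) = lcoset h H.
Proof. by case: (svalP S) => h ->; exists (g * h); rewrite lcosetM. Qed.

Definition translate (H : set G) (g : G) (S : coset_space H) : coset_space H :=
  exist _ (lcoset g (sval S)) (translate_subproof g S).

Definition set_mul (S U : set G) : set G := [set x * y | x in S & y in U].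

Lemma set_mul_lcoset g (S U : set G) :
  set_mul (lcoset g S) U = lcoset g (set_mul S U).
Proof.
apply/seteqP; split=> [_ [_ [x Sx <-] [y Uy <-]]|_ [_ [x Sx [y Uy <-]] <-]].
  by exists (x * y); [exists x => //; exists y|rewrite mulgA].
by exists (g * x); [exists x|exists y => //; rewrite mulgA].
Qed.

End Subgroups.

(* G is the HNN extension of A with stable letter t, identifying the subgroups
   t^-1 C t and C of A. The vertices are the cosets gA and the geometric edges
   the cosets gC; gC joins gA = (gC)A to gtA = (gC)(tA). *)
Section HNN.
Variables (G : groupType) (A C : set G) (t : G).
Hypotheses (subA : subgroup A) (subC : subgroup C) (CA : C `<=` A).
Hypothesis (CtA : forall c, C c -> A (t^-1 * c * t)).

Lemma hnn_origin_subproof (S : coset_space C) :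
  exists g, set_mul (sval S) A = lcoset g A.
Proof using subA subC CA.
case: (svalP S) => g ->; exists g; rewrite set_mul_lcoset; congr lcoset.
case: subA subC => A1 AM _ [C1 _ _].
apply/seteqP; split=> [_ [c Cc [a Aa <-]]|a Aa]; first exact/AM/Aa/CA.
by exists 1 => //; exists a => //; rewrite mul1g.
Qed.

Lemma hnn_target_subproof (S : coset_space C) :
  exists g, set_mul (sval S) (lcoset t A) = lcoset g A.
Proof using subA subC CtA.
case: (svalP S) => g ->; exists (g * t); rewrite set_mul_lcoset -lcosetM.
congr lcoset; case: subA subC => A1 AM _ [C1 _ _].
apply/seteqP; split=> [_ [c Cc [_ [a Aa <-] <-]]|x tAx].
  exists (t^-1 * c * t * a); first exact/AM/Aa/CtA.
  by rewrite !mulgA mulgV mul1g.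
by exists 1 => //; exists x => //; rewrite mul1g.
Qed.

Definition hnn_origin (S : coset_space C) : coset_space A :=
  exist _ _ (hnn_origin_subproof S).

Definition hnn_target (S : coset_space C) : coset_space A :=
  exist _ _ (hnn_target_subproof S).

Definition hnn_edge : Type := (coset_space C * bool)%type.
Definition hnn_rev (e : hnn_edge) : hnn_edge := (e.1, ~~ e.2).
Definition hnn_src (e : hnn_edge) : coset_space A :=
  if e.2 then hnn_target e.1 else hnn_origin e.1.
Definition hnn_tgt (e : hnn_edge) : coset_space A :=
  if e.2 then hnn_origin e.1 else hnn_target e.1.

Lemma hnn_revK : involutive hnn_rev.
Proof using Type. by case=> S b; rewrite /hnn_rev /= negbK. Qed.

Lemma hnn_rev_neq e : hnn_rev e <> e.
Proof using Type. by case: e => S [] []. Qed.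

Lemma hnn_src_rev e : hnn_src (hnn_rev e) = hnn_tgt e.
Proof using Type. by case: e => S []. Qed.

Definition hnn_tree : graph :=
  @Graph (coset_space A) hnn_edge hnn_src hnn_tgt hnn_rev
    hnn_revK hnn_rev_neq hnn_src_rev.

Definition hnn_actv (g : G) (x : coset_space A) : coset_space A := translate g x.
Definition hnn_acte (g : G) (e : hnn_edge) : hnn_edge := (translate g e.1, e.2).

Lemma hnn_actv1 x : hnn_actv 1 x = x.
Proof using Type. by apply: coset_space_inj; rewrite /= lcoset1. Qed.

Lemma hnn_actvM g h x : hnn_actv (g * h) x = hnn_actv g (hnn_actv h x).
Proof using Type. by apply: coset_space_inj; rewrite /= lcosetM. Qed.

Lemma hnn_acte1 e : hnn_acte 1 e = e.
Proof using Type.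
case: e => S b; rewrite /hnn_acte /=; congr pair.
by apply: coset_space_inj; rewrite /= lcoset1.
Qed.

Lemma hnn_acteM g h e : hnn_acte (g * h) e = hnn_acte g (hnn_acte h e).
Proof using Type.
case: e => S b; rewrite /hnn_acte /=; congr pair.
by apply: coset_space_inj; rewrite /= lcosetM.
Qed.

Lemma hnn_src_act g e : hnn_src (hnn_acte g e) = hnn_actv g (hnn_src e).
Proof using Type.
by case: e => S [] /=; apply: coset_space_inj; rewrite /= set_mul_lcoset.
Qed.

Lemma hnn_rev_act g e : hnn_rev (hnn_acte g e) = hnn_acte g (hnn_rev e).
Proof using Type. by []. Qed.

Definition hnn_action : graph_action G hnn_tree :=
  @GraphAction G hnn_tree hnn_actv hnn_acte
    hnn_actv1 hnn_actvM hnn_acte1 hnn_acteM hnn_src_act hnn_rev_act.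

End HNN.

Section BaumslagSolitar.
Variables (m n : nat).

(* The generator a is false and the generator t is true. *)
Inductive BS_rel : word bool -> word bool -> Prop :=
| BSRel : BS_rel ((true, false) :: nseq m (false, false) ++ [:: (true, true)])
                 (nseq n (false, false)).

Definition BS : groupType := presented BS_rel.
Definition BS_a : BS := pres_gen BS_rel false.
Definition BS_t : BS := pres_gen BS_rel true.

Lemma BS_class_nseq k :
  class_of BS_rel (nseq k (false, false)) = BS_a ^+ k :> BS.
Proof.
elim: k => [|k IH] //; rewrite expgS -IH.
exact: (class_of_cat BS_rel [:: (false, false)]).
Qed.

Lemma BS_relation : BS_t * BS_a ^+ m * BS_t^-1 = BS_a ^+ n.
Proof.
rewrite -!BS_class_nseq.
have -> : BS_t^-1 = class_of BS_rel [:: (true, true)].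
  by rewrite -[LHS]class_of_inv.
rewrite -[LHS]class_of_cat; apply/class_ofP.
apply: WordTrans (word_eq_catr _ _) _.
  by apply/class_ofP; exact: esym (class_of_cat _ _ _).
have := WordRel [::] [::] BSRel.
by rewrite !cats0.
Qed.

Definition BS_base : set BS := cyclic_subgroup BS_a.
Definition BS_edge_group : set BS := cyclic_subgroup (BS_a ^+ n).

Lemma BS_edge_base : BS_edge_group `<=` BS_base.
Proof. by move=> _ [k [->|->]]; exists (n * k)%N; rewrite -expgnA; [left|right]. Qed.

Lemma BS_edge_conj c : BS_edge_group c -> BS_base (BS_t^-1 * c * BS_t).
Proof.
have key k : BS_t^-1 * (BS_a ^+ n) ^+ k * BS_t = BS_a ^+ (m * k).
  rewrite -mulgA -/(conjg _ _) conjXg -BS_relation /conjg !mulgA mulVg mul1g -mulgA.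
  by rewrite mulVg mulg1 -expgnA.
case=> k [->|->]; exists (m * k)%N; [left; exact: key|right].
by rewrite -key !invgM invgK mulgA.
Qed.

(* Base group <a>, stable letter t, edge group <a^n> = t <a^m> t^-1. *)
Definition BS_tree : graph :=
  hnn_tree (subgroup_cyclic _) (subgroup_cyclic _) BS_edge_base BS_edge_conj.

Definition BS_action : graph_action BS BS_tree :=
  hnn_action (subgroup_cyclic _) (subgroup_cyclic _) BS_edge_base BS_edge_conj.

End BaumslagSolitar.

(* Main.v *)
Require Import Defs.
From mathcomp Require Import all_boot all_order all_algebra.
From mathcomp Require Import boolp classical_sets reals ereal topology normedtype.
From mathcomp Require Import zify ring lra.

Set Implicit Arguments.
Unset Strict Implicit.
Unset Printing Implicit Defensive.

Import Order.TTheory GRing.Theory Num.Theory.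
Import numFieldNormedType.Exports.

(** Write [b := t * a * t^-1], so that [g = b * a], and [C := <a ^ 3>].

    Lower bound. At a vertex [h A] of the tree, the three edges leaving in the
    direction of [t] are cyclically permuted by the stabilizer of the vertex. Call
    a turn of a walk from one of these edges to another one positive or negative
    according to this cyclic order, and let [D x y] be the number of positive
    turns minus the number of negative turns of the geodesic from [x] to [y]. Since
    geodesic triangles are tripods, [D] is additive up to an error of 3
    ([turn_sum_triangle]), and it is invariant under the group. Hence a product of
    [k] commutators displaces a vertex by at most [12 * k] in terms of [D]
    ([turn_sum_prod_comm]). The axis of [g] makes exactly one turn per period, a
    positive one, so that [D] grows like [N] for [g ^+ N] ([turn_sum_axis]), and
    [N <= 12 * cl (g ^+ N) + 3] ([BS23_cl_lower]).

    Good alignment. The rate of growth of [D] along the orbits of an element, its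
    slope, is a conjugacy invariant and changes sign under inversion. If
    [g * h * g * h^-1] fixed an edge of the axis of [g], the conjugate of [g] by
    [h] would translate this edge along the axis in the opposite direction, and so
    would have slope -1 instead of 1 ([slope_well_aligned]).

    Upper bound. As [b ^+ 2 = a ^+ 3], the subgroup generated by [a] and [b] is a
    quotient of the trefoil group, in which [(b * a) ^+ 6] is the product of the
    central element [a ^+ 15] and a commutator ([trefoil_power6]). Every power of
    [a] is a commutator, since [t * a ^+ (2 * k) * t^-1 = a ^+ (3 * k)], and the
    power [2 * m + 1] of a commutator is a product of [m + 1] commutators
    ([prod_comm_odd_power]). So [g ^+ (6 * (2 * m + 1))] is a product of [m + 2]
    commutators ([BS23_power6]), and the two bounds have the same slope 1/12.

    That the Bass-Serre graph is a tree follows from an action of the group on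
    normal forms: the length of the normal form is a depth function on the
    vertices for which each vertex has a single edge leading down
    ([depth_is_tree], [BS_is_tree]). *)

Lemma least_spec (P : nat -> Prop) (n : nat) :
  P n -> P (least P) /\ least P <= n.
Proof.
move=> Pn; rewrite /least; case: pselect => [h|[]]; last by exists n; apply/asboolP.
case: ex_minnP => k /asboolP Pk min; split=> //.
by apply: min; apply/asboolP.
Qed.

(** * Walks in graphs and geodesics in trees *)

Section Walks.
Variable X : graph.
Implicit Types (x y z : vert X) (e : edge X) (s p q u : seq (edge X)).

Definition rev_walk s : seq (edge X) := rev (map (@rev_edge X) s).

Lemma rev_walkK : involutive rev_walk.
Proof.
move=> s; rewrite /rev_walk map_rev revK -map_comp -[RHS]map_id.
by apply: eq_map => e /=; rewrite rev_edgeK.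
Qed.

Lemma rev_walk_cat s1 s2 : rev_walk (s1 ++ s2) = rev_walk s2 ++ rev_walk s1.
Proof. by rewrite /rev_walk map_cat rev_cat. Qed.

Lemma rev_walk_cons e s : rev_walk (e :: s) = rcons (rev_walk s) (rev_edge e).
Proof. by rewrite /rev_walk /= rev_cons. Qed.

Lemma rev_walk_rcons s e : rev_walk (rcons s e) = rev_edge e :: rev_walk s.
Proof. by rewrite /rev_walk map_rcons rev_rcons. Qed.

Lemma tgt_rev e : tgt (rev_edge e) = src e.
Proof. by rewrite -src_rev rev_edgeK. Qed.

Lemma walk_cat x s1 s2 y :
  walk x (s1 ++ s2) y <-> exists2 z, walk x s1 z & walk z s2 y.
Proof.
elim: s1 x => [|e s1 IH] x /=; first by split=> [h|[z -> //]]; exists x.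
split=> [[ex /IH[z h1 h2]]|[z [ex h1] h2]]; first by exists z.
by split=> //; apply/IH; exists z.
Qed.

Lemma walk_rcons x s e y :
  walk x (rcons s e) y <-> walk x s (src e) /\ tgt e = y.
Proof.
rewrite -cats1 walk_cat; split=> [[z w [-> ez]]|[h ez]] //.
by exists (src e).
Qed.

Lemma walk_rev x s y : walk x s y -> walk y (rev_walk s) x.
Proof.
elim: s x => [|e s IH] x /=; first by move=> ->.
case=> <- /IH h.
by rewrite rev_walk_cons; apply/walk_rcons; rewrite src_rev tgt_rev.
Qed.

Lemma walk_target_unique x s y z : walk x s y -> walk x s z -> y = z.
Proof.
elim: s x => [|e s IH] x /=; first by move=> <- <-.
by case=> _ h1 [_ h2]; exact: IH h1 h2.
Qed.

Lemma reduced_nil : reduced ([::] : seq (edge X)).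
Proof. by case. Qed.

Lemma reduced1 e : reduced [:: e].
Proof. by case=> [|? []]. Qed.

Lemma reduced_cons e s :
  reduced (e :: s) <-> reduced s /\ forall s', s <> rev_edge e :: s'.
Proof.
split=> [h|[h1 h2] [|e1 s1] e' s2]; last 2 first.
- by case=> <-; exact: h2.
- by case=> _; exact: h1.
split=> [s1 e' s2 es|s' es]; first by apply: (h (e :: s1) e' s2); rewrite es.
by apply: (h [::] e s'); rewrite es.
Qed.

Lemma reduced_catl s1 s2 : reduced (s1 ++ s2) -> reduced s1.
Proof. by move=> h u e v es; apply: (h u e (v ++ s2)); rewrite es -catA. Qed.

Lemma reduced_cat s1 s2 :
    reduced s1 -> reduced s2 ->
    (forall s e s', s1 = rcons s e -> s2 <> rev_edge e :: s') ->
  reduced (s1 ++ s2).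
Proof.
elim: s1 => [|e s1 IH] //= /reduced_cons[r1 h1] r2 h.
apply/reduced_cons; split=> [|s'].
  by apply: IH => // s e' s' es; apply: (h (e :: s)); rewrite es.
case: s1 h1 h {IH r1} => [|e1 s1] h1 h /=; first exact: (h [::]).
by case=> ee _; apply: (h1 s1); rewrite ee.
Qed.

(** Reducedness only concerns consecutive pairs of edges, so two walks that
    overlap in one edge can be glued. *)
Lemma reduced_glue s e s' :
  reduced (rcons s e) -> reduced (e :: s') -> reduced (s ++ e :: s').
Proof.
move=> r1 r2; apply: reduced_cat r2 _; first by move: r1; rewrite -cats1 => /reduced_catl.
move=> u e1 v es [ee _]; apply: (r1 u e1 [::]).
by rewrite es ee -!cats1 -catA.
Qed.

Lemma reduced_rev s : reduced s -> reduced (rev_walk s).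
Proof.
move=> h u e v es; apply: (h (rev_walk v) e (rev_walk u)).
rewrite -[s]rev_walkK es rev_walk_cat !rev_walk_cons rev_edgeK.
by rewrite -!cats1 -!catA.
Qed.

(** Concatenating two reduced walks and cancelling backtracks removes a common
    piece: in a tree, these are two sides of a tripod and the third one. *)
Lemma reduced_cancel p q :
    reduced p -> reduced q ->
  exists u p' q', [/\ p = p' ++ u, q = rev_walk u ++ q' & reduced (p' ++ q')].
Proof.
elim/last_ind: p q => [|p e IH] q rp rq; first by exists [::], [::], q.
have [[q1 eq1]|nq] := pselect (exists q1, q = rev_edge e :: q1).
  move: rp rq; rewrite eq1 -cats1 => /reduced_catl rp /reduced_cons[rq _].
  have [u [p' [q' [-> -> h]]]] := IH q1 rp rq.
  by exists (rcons u e), p', q'; rewrite rev_walk_rcons -cats1 !catA.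
exists [::], (rcons p e), q; rewrite cats0; split=> //.
apply: reduced_cat => // s e' s' /rcons_inj[_ <-] eqq.
by apply: nq; exists s'.
Qed.

(** A backtrack could be removed. *)
Lemma minimal_walk_reduced x s y :
    walk x s y -> (forall s', walk x s' y -> size s <= size s') -> reduced s.
Proof.
move=> + min s1 e s2 es; rewrite es => /walk_cat[z h1 /= [ez [_ h2]]].
have /min : walk x (s1 ++ s2) y.
  by apply/walk_cat; exists z => //; rewrite tgt_rev ez in h2.
by rewrite es !size_cat /=; lia.
Qed.

Lemma dist_walk x s y :
  walk x s y -> (exists2 s', walk x s' y & size s' = dist x y) /\ dist x y <= size s.
Proof.
move=> h; have [[s' [h1 h2]] h3] :=
  @least_spec (fun n => exists s, walk x s y /\ size s = n) _ (ex_intro _ s (conj h erefl)).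
by split=> //; exists s'.
Qed.

Hypothesis treeX : is_tree X.

Lemma tree_walk x y : exists s, walk x s y.
Proof. by case: treeX. Qed.

Lemma tree_reduced_unique x y p q :
  walk x p y -> reduced p -> walk x q y -> reduced q -> p = q.
Proof.
move=> wp rp wq rq.
have [u [p' [q' [ep eq r]]]] := reduced_cancel rp (reduced_rev rq).
have : p' ++ q' = [::].
  case: treeX => _ _ acyclic; apply: (acyclic x) => //.
  move: wp (walk_rev wq); rewrite ep eq => /walk_cat[z h1 h2] /walk_cat[z' h3 h4].
  apply/walk_cat; exists z => //.
  by rewrite (walk_target_unique (walk_rev h2) h3).
case: p' q' ep eq {r} => // -[|//] /= ep; rewrite cats0 => /(congr1 rev_walk).
by rewrite !rev_walkK => ->.
Qed.

Lemma dist_minimal x s y : walk x s y -> size s = dist x y -> reduced s.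
Proof.
move=> w es; apply: (minimal_walk_reduced w) => s' /dist_walk[_].
by rewrite es.
Qed.

Lemma dist_reduced x s y : walk x s y -> reduced s -> dist x y = size s.
Proof.
move=> w r; have [[s' w' es'] _] := dist_walk w.
by rewrite -es' (tree_reduced_unique w r w') //; exact: dist_minimal es'.
Qed.

Lemma geodesic_subproof x y : exists s, walk x s y /\ reduced s.
Proof.
have [s w] := tree_walk x y; have [[s' w' es'] _] := dist_walk w.
by exists s'; split=> //; exact: dist_minimal es'.
Qed.

Definition geodesic x y : seq (edge X) := sval (cid (geodesic_subproof x y)).

Lemma geodesic_walk x y : walk x (geodesic x y) y.
Proof. by rewrite /geodesic; case: cid => s []. Qed.

Lemma geodesic_reduced x y : reduced (geodesic x y).
Proof. by rewrite /geodesic; case: cid => s []. Qed.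

Lemma geodesicE x s y : walk x s y -> reduced s -> geodesic x y = s.
Proof.
by apply: tree_reduced_unique; [exact: geodesic_walk|exact: geodesic_reduced].
Qed.

End Walks.

(** * Counting turns along geodesics *)

Section Turns.
Variables (X : graph) (j : edge X -> edge X -> int).
Implicit Types (x y z : vert X) (e : edge X) (s p q : seq (edge X)).

Fixpoint turns s : int :=
  match s with
  | e1 :: (e2 :: _) as s' => (j e1 e2 + turns s')%R
  | _ => 0%R
  end.

Lemma turns_glue s e s' :
  turns (s ++ e :: s') = (turns (rcons s e) + turns (e :: s'))%R.
Proof.
elim: s => [|e1 [|e2 s] IH] //=; first by rewrite add0r.
- by rewrite addr0.
- by move: IH => /= ->; rewrite addrA.
Qed.

Hypothesis j_rev : forall e1 e2, j (rev_edge e2) (rev_edge e1) = (- j e1 e2)%R.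
Hypothesis j_le1 : forall e1 e2, (`|j e1 e2| <= 1)%R.

Lemma turns_rev s : turns (rev_walk s) = (- turns s)%R.
Proof.
elim: s => [|e1 [|e2 s] IH] //; rewrite rev_walk_cons rev_walk_cons.
rewrite -cats1 cat_rcons turns_glue -rev_walk_cons IH /= j_rev.
by rewrite addr0 opprD addrC.
Qed.

Lemma turns_cat s1 s2 :
  exists2 d : int, turns (s1 ++ s2) = (turns s1 + turns s2 + d)%R & (`|d| <= 1)%R.
Proof.
case/lastP: s1 => [|s1 e1]; first by exists 0%R => //=; rewrite add0r addr0.
case: s2 => [|e2 s2]; first by exists 0%R => //=; rewrite cats0 !addr0.
exists (j e1 e2); last exact: j_le1.
by rewrite -cats1 -catA /= turns_glue /= cats1; ring.
Qed.

Hypothesis treeX : is_tree X.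

Definition turn_sum x y : int := turns (geodesic treeX x y).
Local Notation D := turn_sum.

Lemma turn_sumE x s y : walk x s y -> reduced s -> D x y = turns s.
Proof. by move=> w r; rewrite /D (geodesicE treeX w r). Qed.

Lemma turn_sumxx x : D x x = 0%R.
Proof. exact: (@turn_sumE _ [::] _ erefl (@reduced_nil X)). Qed.

Lemma turn_sumC x y : D y x = (- D x y)%R.
Proof.
rewrite (@turn_sumE _ (rev_walk (geodesic treeX x y))) ?turns_rev //.
  exact/walk_rev/geodesic_walk.
exact/reduced_rev/geodesic_reduced.
Qed.

(** The sides of a geodesic triangle form a tripod: the turns inside its legs
    cancel, and each of the three sides contributes one turn at the centre. *)
Lemma turn_sum_triangle x y z : (`|D x y + D y z - D x z| <= 3)%R.
Proof.
have [u [p [q [ep eq r]]]] :=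
  reduced_cancel (@geodesic_reduced _ treeX x y) (@geodesic_reduced _ treeX y z).
have w : walk x (p ++ q) z.
  move: (geodesic_walk treeX x y) (geodesic_walk treeX y z).
  rewrite ep eq => /walk_cat[v w1 w2] /walk_cat[v' w3 w4].
  by apply/walk_cat; exists v => //; rewrite (walk_target_unique (walk_rev w2) w3).
rewrite (turn_sumE w r) /D ep eq.
have [d1 -> h1] := turns_cat p u; have [d2 -> h2] := turns_cat (rev_walk u) q.
by have [d3 -> h3] := turns_cat p q; rewrite turns_rev; lia.
Qed.

Variables (G : groupType) (act : graph_action G X).
Local Notation "g *v x" := (actv act g x) (at level 40).
Local Notation "g *e e" := (acte act g e) (at level 40).

Lemma actvK g x : g^-1%g *v (g *v x) = x.
Proof. by rewrite -actvM mulVg actv1. Qed.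

Lemma acteK g e : g^-1%g *e (g *e e) = e.
Proof. by rewrite -acteM mulVg acte1. Qed.

Lemma tgt_act g e : tgt (g *e e) = g *v tgt e.
Proof. by rewrite -!src_rev rev_act src_act. Qed.

Lemma walk_act g x s y : walk x s y -> walk (g *v x) (map (acte act g) s) (g *v y).
Proof.
elim: s x => [|e s IH] x /=; first by move=> ->.
by case=> <- /IH; rewrite src_act tgt_act.
Qed.

Lemma reduced_act g s : reduced s -> reduced (map (acte act g) s).
Proof.
move=> h u e v es; apply: (h (map (acte act g^-1%g) u) (g^-1%g *e e) (map (acte act g^-1%g) v)).
have := congr1 (map (acte act g^-1%g)) es.
rewrite -map_comp map_cat /= rev_act => <-.
by rewrite -[LHS]map_id; apply: eq_map => e' /=; rewrite acteK.
Qed.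

Hypothesis j_act : forall g e1 e2, j (g *e e1) (g *e e2) = j e1 e2.

Lemma turns_act g s : turns (map (acte act g) s) = turns s.
Proof. by elim: s => [|e1 [|e2 s] IH] //=; rewrite j_act; move: IH => /= ->. Qed.

Lemma turn_sum_act g x y : D (g *v x) (g *v y) = D x y.
Proof.
rewrite (turn_sumE (walk_act g (geodesic_walk treeX x y))) ?turns_act //.
exact/reduced_act/geodesic_reduced.
Qed.

(** The function sending [g] to [D x (g *v x)] is an antisymmetric
    quasimorphism of defect 3. A commutator is a product of four elements whose
    values cancel in pairs, hence has value at most 9, and each of the other
    products costs 3. *)
Lemma turn_sum_prod_comm x k g : prod_comm k g -> (D x (g *v x) <= (12 * k)%:Z)%R.
Proof.
have Dmul a b : (`|D x ((a * b)%g *v x) - D x (a *v x) - D x (b *v x)| <= 3)%R.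
  have := turn_sum_triangle x (a *v x) ((a * b)%g *v x).
  by rewrite actvM turn_sum_act; lia.
have Dinv a : D x (a^-1%g *v x) = (- D x (a *v x))%R.
  by rewrite -(turn_sum_act a) -actvM mulgV actv1 turn_sumC.
case=> s <- ->; elim: s => [|[a b] s IH].
  by rewrite big_nil actv1 turn_sumxx.
rewrite big_cons /=; set c := bigop _ _ _ in IH *.
have := Dmul [~ a, b]%g c.
have := Dmul (a^-1)%g (a ^ b)%g.
have := Dmul (b^-1)%g (a * b)%g; have := Dmul a b.
have := Dinv a; have := Dinv b; rewrite -commgEl -conjgE.
move: (D x _) IH (D x _) (D x _) (D x _) (D x _) (D x _) (D x _) (D x _) (D x _).
by move=> *; lia.
Qed.

(** This says that the homogenization of the quasimorphism above takes the value
    [v] at [g], without taking a limit; with two arbitrary vertices, it depends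
    on no base point. *)
Definition has_slope g (v : int) : Prop :=
  forall x y, exists B : int, forall n : nat,
    (`|D x ((g ^+ n)%g *v y) - v *+ n| <= B)%R.

Lemma has_slopeI g v x y (B : int) :
    (forall n : nat, (`|D x ((g ^+ n)%g *v y) - v *+ n| <= B)%R) ->
  has_slope g v.
Proof.
move=> h x' y'; exists (B + `|D x x'| + `|D y y'| + 6)%R => n.
have := h n; have := turn_sum_triangle x x' ((g ^+ n)%g *v y').
have := turn_sum_triangle x ((g ^+ n)%g *v y) ((g ^+ n)%g *v y').
by rewrite turn_sum_act; lia.
Qed.

Lemma has_slope_unique g v w : has_slope g v -> has_slope g w -> v = w.
Proof.
case: treeX => [[x _] _ _] /(_ x x)[B hB] /(_ x x)[C hC].
apply/eqP; apply: contraT => nvw.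
pose n := (absz (B + C)%R).+1.
have : (n%:Z <= `|(v - w) *+ n|)%R.
  rewrite -mulr_natl normrM natz ger0_norm // ler_peMr //.
  by move: nvw; lia.
by have := hB n; have := hC n; rewrite mulrnBl /n; lia.
Qed.

Lemma has_slope_fix g x : g *v x = x -> has_slope g 0%R.
Proof.
move=> gx; apply: (@has_slopeI _ _ x x 0%R) => n.
have -> : (g ^+ n)%g *v x = x.
  by elim: n => [|n IH]; rewrite ?actv1 // expgSr actvM gx.
by rewrite turn_sumxx mul0rn.
Qed.

Lemma has_slopeV g v : has_slope g v -> has_slope g^-1%g (- v)%R.
Proof.
move=> h x y; have [B hB] := h y x; exists B => n.
have := hB n; rewrite expVgn -(turn_sum_act (g ^+ n)%g x) -actvM mulgV actv1.
by rewrite turn_sumC mulNrn; lia.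
Qed.

Lemma has_slopeJ g h v : has_slope g v -> has_slope (h * g * h^-1)%g v.
Proof.
move=> hv x y; have [B hB] := hv (h^-1%g *v x) (h^-1%g *v y).
exists B => n; rewrite -(turn_sum_act h^-1%g) -actvM.
have -> : (h^-1 * (h * g * h^-1) ^+ n = g ^+ n * h^-1)%g.
  elim: n => [|n IH]; first by rewrite mulg1 mul1g.
  by rewrite !expgS -(mulgA g) -IH !mulgA mulVg mul1g.
by rewrite actvM.
Qed.

End Turns.

(** * Axes, and a criterion for being well-aligned *)

Section Axes.
Variables (X : graph) (j : edge X -> edge X -> int).
Hypothesis j_rev : forall e1 e2, j (rev_edge e2) (rev_edge e1) = (- j e1 e2)%R.
Hypothesis j_le1 : forall e1 e2, (`|j e1 e2| <= 1)%R.
Hypothesis treeX : is_tree X.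
Variables (G : groupType) (act : graph_action G X).
Hypothesis j_act : forall g e1 e2, j (acte act g e1) (acte act g e2) = j e1 e2.
Local Notation "g *v x" := (actv act g x) (at level 40).
Local Notation "g *e e" := (acte act g e) (at level 40).
Local Notation D := (turn_sum j treeX).

(** If the geodesic from an edge to its translate extends to both edges, the
    translates of that geodesic fit together into an axis, along which turns are
    counted exactly. *)
Lemma turn_sum_axis g e p :
    walk (src e) (e :: p) (g *v src e) ->
    reduced (rcons (e :: p) (g *e e)) ->
  forall n, D (src e) ((g ^+ n)%g *v tgt e)
            = (turns j (rcons (e :: p) (g *e e)) *+ n)%R.
Proof.
move=> w r n; set v := turns _ _.
suff [s [ws rs <-]] : exists s, [/\ walk (src e) (e :: s) ((g ^+ n)%g *v tgt e),
    reduced (e :: s) & turns j (e :: s) = (v *+ n)%R].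
  exact: turn_sumE.
elim: n => [|n [s [ws rs ts]]].
  by exists [::]; rewrite actv1; split=> //; exact: reduced1.
exists (p ++ map (acte act g) (e :: s)); rewrite -cat_cons; split.
- by apply/walk_cat; exists (g *v src e); rewrite // expgS actvM; exact: walk_act.
- by apply: reduced_glue r _; exact: (reduced_act rs).
- rewrite [map _ _]/= turns_glue mulrS -ts -/v; congr (_ + _)%R.
  exact: (turns_act j_act g (e :: s)).
Qed.

Lemma has_slope_axis g e p :
    walk (src e) (e :: p) (g *v src e) ->
    reduced (rcons (e :: p) (g *e e)) ->
  has_slope j treeX act g (turns j (rcons (e :: p) (g *e e))).
Proof.
move=> w r; apply: (@has_slopeI _ _ j_rev j_le1 _ _ _ j_act _ _ (src e) (tgt e) 0%R) => n.
by rewrite (turn_sum_axis w r) subrr normr0.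
Qed.

(** If the geodesic from the source of [e] to its image neither starts with [e] nor
    ends with the image of [rev_edge e], it can be extended at both ends to a
    geodesic from the target of [e] to its image, which is then too long. *)
Lemma axis_edge_walk g e :
    without_inversions act -> hyperbolic act g -> axis_edge act g e ->
  exists e' p, [/\ e' = e \/ e' = rev_edge e,
    walk (src e') (e' :: p) (g *v src e') & reduced (rcons (e' :: p) (g *e e'))].
Proof.
rewrite /hyperbolic => noinv L0 [ax ay]; rewrite /axis /= in ax ay.
set x := src e in ax *; set y := tgt e in ay *.
have wp := geodesic_walk treeX x (g *v x).
have rp := @geodesic_reduced _ treeX x (g *v x).
have sp := dist_reduced treeX wp rp; rewrite ax in sp.
set p := geodesic _ _ _ in wp rp sp.
(* The edge points along the axis. *)
have [[p' ep]|np] := pselect (exists p', p = e :: p').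
  exists e, p'; rewrite -ep; split=> //; first by left.
  have rq : reduced (rcons p' (g *e e)).
    apply: (@dist_minimal _ y _ (g *v y)); last by rewrite ay sp ep size_rcons.
    move: wp; rewrite ep => -[_ wp']; apply/walk_rcons.
    by rewrite src_act tgt_act.
  rewrite ep rcons_cons; apply/reduced_cons; split=> // s'.
  case: p' ep rq => [|e1 p'] ep _; first by case=> /noinv.
  by case=> ee _; apply: (rp [::] e p'); rewrite ep ee.
(* The edge points against the axis. *)
have [[p' ep]|np'] := pselect (exists p', p = rcons p' (g *e rev_edge e)).
  exists (rev_edge e), p'; rewrite rcons_cons -ep src_rev; split.
  - by right.
  - split; first by rewrite src_rev.
    move: wp; rewrite ep => /walk_rcons[+ _].
    by rewrite src_act src_rev tgt_rev.
  - apply/reduced_cons; split=> // s'; rewrite rev_edgeK => ep'.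
    by apply: np; exists s'.
have r : reduced (rev_edge e :: rcons p (g *e e)).
  apply/reduced_cons; split=> [|s'].
    rewrite -cats1; apply: reduced_cat => // [|s1 e1 s' es [ee _]].
      exact: reduced1.
    by apply: np'; exists s1; rewrite -rev_act ee rev_edgeK.
  rewrite rev_edgeK => es; apply: np.
  case: (p) sp es => [|e1 p1] /=; first by move=> L1; rewrite L1 in L0.
  by move=> _ [-> _]; exists p1.
have w : walk y (rev_edge e :: rcons p (g *e e)) (g *v y).
  by split; [exact: src_rev|apply/walk_rcons; rewrite src_act tgt_rev tgt_act].
by have := dist_reduced treeX w r; rewrite ay /= size_rcons sp; lia.
Qed.

(** If [g * (h * g * h^-1)] fixes an edge of the axis of [g], then the conjugate
    [h * g * h^-1] translates this edge along that axis as [g^-1] does; so its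
    slope is opposite to that of [g], although the slope is a conjugacy
    invariant. *)
Lemma slope_well_aligned g v :
    without_inversions act -> has_slope j treeX act g v -> v <> 0%R ->
  well_aligned act g.
Proof.
move=> noinv gv v0.
have hyp : hyperbolic act g.
  rewrite /hyperbolic lt0n; apply/eqP => L0; apply: v0.
  have [[x _] _ _] := treeX.
  have [[y dy] _] := @least_spec
    (fun n => exists x, dist x (g *v x) = n) _ (ex_intro _ x erefl).
  rewrite -/(translation_length act g) L0 in dy.
  have [s ws] := tree_walk treeX y (g *v y).
  have [[s' ws' s0] _] := dist_walk ws; rewrite dy in s0.
  move/size0nil: s0 ws' => -> /= gy.
  by apply: (has_slope_unique gv); exact: has_slope_fix (esym gy).
split=> // -[h [e axe fixe]].
have [e' [p [ee w r]]] := axis_edge_walk noinv hyp axe.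
have {}fixe : (g * h * g * h^-1)%g *e e' = e'.
  by case: ee => -> //; rewrite -rev_act fixe.
(* The conjugate [k] sends [e'] to [g^-1 e'], so that [k^-1] translates [g^-1 e']
   along the image under [g^-1] of the walk [e' :: p]. *)
set k := (h * g * h^-1)%g.
have ke : k *e e' = g^-1%g *e e'.
  by rewrite -[RHS]/(acte act g^-1%g e') -{2}fixe -acteM !mulgA mulVg mul1g.
have kge : k^-1%g *e (g^-1%g *e e') = e' by rewrite -ke acteK.
have kv : has_slope j treeX act k v by exact: has_slopeJ.
have vw := has_slope_unique gv (has_slope_axis w r).
apply: v0.
have : has_slope j treeX act k^-1%g v.
  have kv' := @has_slope_axis k^-1%g (g^-1%g *e e') (map (acte act g^-1%g) p).
  rewrite kge in kv'; rewrite vw -(turns_act j_act g^-1%g) map_rcons acteK.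
  apply: kv'.
    rewrite -src_act kge src_act.
    by have := walk_act act g^-1%g w; rewrite actvK.
  by have := reduced_act (act := act) (g := g^-1%g) r; rewrite map_rcons acteK.
by move/(has_slope_unique (has_slopeV j_rev j_act kv)) => /eqP; lia.
Qed.

End Axes.

(** * A depth function that makes a graph a tree *)

(** When every edge changes the depth and every vertex has at most one edge
    leading downwards, a reduced walk never goes up and then down; a closed one
    starts down and ends up through the same edge. *)
Lemma depth_is_tree (X : graph) (depth : vert X -> nat) :
    (exists x : vert X, True) ->
    (forall x y : vert X, exists s, walk x s y) ->
    (forall e : edge X, depth (src e) <> depth (tgt e)) ->
    (forall e e' : edge X, src e = src e' -> depth (tgt e) < depth (src e) ->
       depth (tgt e') < depth (src e') -> e = e') ->
  is_tree X.
Proof.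
move=> nonempty conn step down; split=> //.
have up x e s y : walk x (e :: s) y -> reduced (e :: s) ->
    depth (src e) < depth (tgt e) -> depth x < depth y.
  elim: s x e => [|e' s IH] x e /= [<- w] r lt_e; first by rewrite -w.
  have [ee' w'] := w; have [r' nb] := (reduced_cons _ _).1 r.
  apply: (ltn_trans lt_e); apply: (IH _ e') => //.
  rewrite ltnNge leq_eqVlt; apply/negP => /orP[/eqP/esym/step //|lt_e'].
  apply: (nb s); congr (_ :: _); apply: down => //.
  - by rewrite src_rev.
  - by rewrite tgt_rev src_rev.
move=> x s; have [n] := ubnP (size s); elim: n x s => // n IH x s.
case: s => // e s sn w r; exfalso.
case/lastP: s => [|s e1] in sn w r.
  by case: w => <- /= h; apply: (step e); rewrite h.
have dn_e : depth (tgt e) < depth (src e).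
  rewrite ltnNge leq_eqVlt; apply/negP => /orP[/eqP/step //|].
  by move/(up _ _ _ _ w r); rewrite ltnn.
have dn_e1 : depth (src e1) < depth (tgt e1).
  rewrite ltnNge leq_eqVlt; apply/negP => /orP[/eqP/esym/step //|lt1].
  have := walk_rev w; have := reduced_rev r; rewrite -rcons_cons rev_walk_rcons.
  by move=> r' /up -/(_ r'); rewrite src_rev tgt_rev ltnn => /(_ lt1).
case: w => ex w; move/walk_rcons: (w) => [w' ey].
have ee : rev_edge e1 = e.
  by apply: down => //; rewrite ?tgt_rev src_rev // ey ex.
have [rs nb] := (reduced_cons _ _).1 r.
have s0 : s = [::].
  apply: (IH (tgt e)).
  - by move: sn; rewrite /= size_rcons; lia.
  - by rewrite -{2}ee tgt_rev.
  - by move: rs; rewrite -cats1 => /reduced_catl.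
by apply: (nb [::]); rewrite s0 -ee rev_edgeK.
Qed.

(** * Cosets and integer powers *)

Section Cosets.
Variable G : groupType.
Implicit Types (g h x : G).

Definition coset (H : set G) g : coset_space H :=
  exist _ (lcoset g H) (ex_intro _ g erefl).

Lemma coset_surj (H : set G) (S : coset_space H) : exists g, S = coset H g.
Proof. by case: (svalP S) => g eS; exists g; exact: coset_space_inj. Qed.

Lemma coset_eqP (H : set G) g h :
  subgroup H -> coset H g = coset H h <-> H (g^-1 * h)%g.
Proof.
move=> [H1 HM HV]; split=> [/(congr1 sval)/= e|Hgh].
  have : lcoset h H h by exists 1%g; rewrite ?mulg1.
  by rewrite -e => -[x Hx <-]; rewrite mulKg.
apply: coset_space_inj => /=; apply/seteqP; split=> _ [x Hx <-].
  exists ((g^-1 * h)^-1 * x)%g; first exact/HM/Hx/HV.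
  by rewrite invgM invgK !mulgA mulgV mul1g.
by exists (g^-1 * h * x)%g; [exact: HM|rewrite !mulgA mulgV mul1g].
Qed.

Lemma translate_coset (H : set G) g h : translate g (coset H h) = coset H (g * h)%g.
Proof. by apply: coset_space_inj; rewrite /= lcosetM. Qed.

Definition zpow x (k : int) : G :=
  match k with Posz n => x ^+ n | Negz n => x ^- n.+1 end%g.

Lemma zpowS x k : zpow x (k + 1)%R = (zpow x k * x)%g.
Proof.
case: k => n; first by rewrite -PoszD addn1 /= expgSr.
case: n => [|n]; first by rewrite /= expg1 mulVg.
have -> : (Negz n.+1 + 1 = Negz n)%R by lia.
by rewrite /= [X in (X^-1 * x)%g]expgS invgM mulgVK.
Qed.

Lemma zpowP x k : zpow x (k - 1)%R = (zpow x k * x^-1)%g.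
Proof. by rewrite -{2}[k](subrK 1%R) zpowS mulgK. Qed.

Lemma zpowD x k l : zpow x (k + l)%R = (zpow x k * zpow x l)%g.
Proof.
elim/int_rec: l => [|n IH|n IH].
- by rewrite addr0 mulg1.
- by rewrite intS (addrC 1%R) addrA !zpowS IH mulgA.
- by rewrite intS opprD (addrC (- 1)%R) addrA !zpowP IH mulgA.
Qed.

Lemma zpowN x k : zpow x (- k)%R = (zpow x k)^-1%g.
Proof. by apply: (mulgI (zpow x k)); rewrite -zpowD subrr mulgV. Qed.

Lemma cyclic_subgroupE x y : cyclic_subgroup x y <-> exists k, y = zpow x k.
Proof.
split=> [[k [->|->]]|[[n|n] ->]].
- by exists (k%:Z)%R.
- by exists (- k%:Z)%R; rewrite zpowN.
- by exists n; left.
- by exists n.+1; right.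
Qed.

Lemma zpow_expg x n k : zpow (x ^+ n)%g k = zpow x (k * n%:Z)%R.
Proof.
case: k => k; first by rewrite -PoszM mulnC /= expgnA.
by rewrite NegzE mulNr -PoszM !zpowN mulnC /= expgnA.
Qed.

Lemma zpow_conj x y k : (y * zpow x k * y^-1)%g = zpow (y * x * y^-1)%g k.
Proof.
have e n : (y * x ^+ n * y^-1 = (y * x * y^-1) ^+ n)%g.
  by have := conjXg x y^-1%g n; rewrite /conjg invgK !mulgA.
by case: k => n; rewrite /= -e // !invgM invgK mulgA.
Qed.

End Cosets.

Section HNNCosets.
Variables (G : groupType) (A C : set G) (t : G).
Hypotheses (subA : subgroup A) (subC : subgroup C) (CA : (C `<=` A)%classic).
Hypothesis (CtA : forall c, C c -> A (t^-1 * c * t)%g).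

Lemma hnn_origin_coset h : hnn_origin subA subC CA (coset C h) = coset A h.
Proof.
apply: coset_space_inj; rewrite /= set_mul_lcoset; congr lcoset.
case: subA subC => A1 AM _ [C1 _ _].
apply/seteqP; split=> [_ [c Cc [x Ax <-]]|x Ax]; first exact/AM/Ax/CA.
by exists 1%g => //; exists x => //; rewrite mul1g.
Qed.

Lemma hnn_target_coset h : hnn_target subA subC CtA (coset C h) = coset A (h * t)%g.
Proof.
apply: coset_space_inj; rewrite /= set_mul_lcoset -lcosetM; congr lcoset.
case: subA subC => A1 AM _ [C1 _ _].
apply/seteqP; split=> [_ [c Cc [_ [x Ax <-] <-]]|x tAx].
  exists (t^-1 * c * t * x)%g; first exact/AM/Ax/CtA.
  by rewrite !mulgA mulgV mul1g.
by exists 1%g => //; exists x => //; rewrite mul1g.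
Qed.

End HNNCosets.

(** * Normal forms in Baumslag-Solitar groups *)

Section NormalForms.
Variables (m n : nat).
Hypotheses (m_gt0 : 0 < m) (n_gt0 : 0 < n).

(** The pair [(l, i)] stands for the product of the [a ^ r * t ^ (+-1)] for the
    entries [(r, b)] of [l], read from its last entry to its first one, followed
    by [a ^ i]; the sign is minus when [b] holds, as for letters of words. With
    this order of reading, right multiplication by a generator only changes the
    head of the list. *)
Definition nform : Type := (seq (int * bool) * int)%type.

(** [a ^ modulus b] can be moved from left to right through [t ^ (+-1)], where it
    becomes [a ^ modulus (~~ b)]. *)
Definition modulus (b : bool) : int := if b then m else n.

Definition nf_cancels (b : bool) (s : nform) : bool :=
  (modulus b %| s.2)%Z && (if s.1 is (_, b') :: _ then b' == ~~ b else false).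

Definition nf_mult (b : bool) (s : nform) : nform :=
  if nf_cancels b s then
    (behead s.1, (head (0, b) s.1).1 + (s.2 %/ modulus b)%Z * modulus (~~ b))%R
  else (((s.2 %% modulus b)%Z, b) :: s.1, ((s.2 %/ modulus b)%Z * modulus (~~ b))%R).

Fixpoint nf_valid (l : seq (int * bool)) : bool :=
  if l is (r, b) :: l' then
    [&& (0 <= r < modulus b)%R, ~~ nf_cancels b (l', r) & nf_valid l']
  else true.

Lemma modulus_gt0 b : (0 < modulus b)%R.
Proof. by case: b; rewrite /modulus ltz_nat. Qed.

Lemma modulus_neq0 b : modulus b != 0%R.
Proof. by rewrite gt_eqF ?modulus_gt0. Qed.

Lemma nf_mult_valid b s : nf_valid s.1 -> nf_valid (nf_mult b s).1.
Proof.
case: s => l i vl; rewrite /nf_mult /=; case: ifP => [_|ns].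
  by case: l vl => [|[r b'] l] //= /and3P[].
rewrite /= vl andbT modz_ge0 ?modulus_neq0 // ltz_pmod ?modulus_gt0 //=.
have dvdE d k : (d %| k)%Z = ((k %% d)%Z == 0%R) by exact: sameP dvdz_mod0P eqP.
by move: ns; rewrite /nf_cancels /= !dvdE modz_mod => ->.
Qed.

(** After a cancellation, the inverse step has to restore the removed letter; this
    is what [nf_valid] ensures, since that letter does not itself cancel against
    the rest of the list and its exponent is a remainder. *)
Lemma nf_multK b s : nf_valid s.1 -> nf_mult (~~ b) (nf_mult b s) = s.
Proof.
case: s => l i vl; rewrite {2}/nf_mult /=; case: ifP => [|ns].
  case: l vl => [|[r b'] l]; rewrite /nf_cancels /= ?andbF //.
  case/and3P=> /andP[r0 rd] ns vl /andP[di /eqP eb']; subst b'.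
  have er : (((r + (i %/ modulus b)%Z * modulus (~~ b)) %/ modulus (~~ b))%Z
            = (i %/ modulus b)%Z)%R.
    rewrite addrC divzMDl ?modulus_neq0 // [(r %/ _)%Z]divz_small ?addr0 //.
    by apply/andP; split=> //; case: (b) rd.
  rewrite /nf_mult; have -> : nf_cancels (~~ b)
      (l, (r + (i %/ modulus b)%Z * modulus (~~ b))%R) = nf_cancels (~~ b) (l, r).
    rewrite /nf_cancels /=; congr (_ && _).
    by rewrite rpredDr // dvdz_mull.
  rewrite (negbTE ns) /= er negbK divzK //.
  by rewrite addrC modzMDl modz_small //; apply/andP; split=> //; case: (b) rd.
rewrite /nf_mult {1}/nf_cancels /= negbK eqxx andbT dvdz_mull //=.
by rewrite mulzK ?modulus_neq0 // addrC -divz_eq.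
Qed.

Lemma nf_mult_shift b l i k :
  nf_mult b (l, (i + k * modulus b)%R) =
  ((nf_mult b (l, i)).1, ((nf_mult b (l, i)).2 + k * modulus (~~ b))%R).
Proof.
have st : nf_cancels b (l, (i + k * modulus b)%R) = nf_cancels b (l, i).
  by rewrite /nf_cancels /=; congr (_ && _); rewrite rpredDr // dvdz_mull.
rewrite /nf_mult st; case: ifP => _ /=; rewrite (addrC i) divzMDl ?modulus_neq0 //.
  by congr pair; ring.
by rewrite modzMDl; congr pair; ring.
Qed.

Definition nf_letter (s : nform) (x : bool * bool) : nform :=
  if x.1 then nf_mult x.2 s else (s.1, if x.2 then (s.2 - 1)%R else (s.2 + 1)%R).

Definition nf_word (s : nform) (w : word bool) : nform := foldl nf_letter s w.

Lemma nf_word_valid s w : nf_valid s.1 -> nf_valid (nf_word s w).1.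
Proof.
elim: w s => [|[[] b] w IH] s vs //=; apply: IH => //=.
exact: nf_mult_valid.
Qed.

Lemma nf_word_nseq s k :
  nf_word s (nseq k (false, false)) = (s.1, (s.2 + k%:Z)%R).
Proof.
elim: k s => [|k IH] [l i] /=; first by rewrite addr0.
by rewrite IH /= -addrA -intS.
Qed.

(** The action of words on valid normal forms factors through the group; in this
    way normal forms become an invariant of group elements. *)
Lemma nf_word_eq w1 w2 s :
  word_eq (BS_rel m n) w1 w2 -> nf_valid s.1 -> nf_word s w1 = nf_word s w2.
Proof.
move=> h; elim: h s => {w1 w2} [w|w1 w2 _ IH|w1 w2 w3 _ IH1 _ IH2|u l v|u r r' v h] s vs //.
- by rewrite IH.
- by rewrite IH1 ?IH2.
- rewrite /nf_word !foldl_cat /=; congr foldl.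
  have := nf_word_valid u vs; rewrite -/(nf_word s u); case: (nf_word s u) => l' i.
  case: l => [[] b] /= vl; first by rewrite /nf_letter /= nf_multK.
  by rewrite /nf_letter; case: b; rewrite /= ?subrK ?addrK.
rewrite /nf_word !foldl_cat; congr foldl.
have := nf_word_valid u vs; rewrite -/(nf_word s u); case: (nf_word s u) => l i /= vl.
case: h; rewrite /= foldl_cat -!/(nf_word _ _) !nf_word_nseq /= /nf_letter /=.
have -> : (n%:Z = 1 * modulus false)%R by rewrite mul1r.
have -> : (m%:Z = 1 * modulus true)%R by rewrite mul1r.
by rewrite -[RHS](@nf_multK false) // [nf_mult false (l, (i + _)%R)]nf_mult_shift.
Qed.

End NormalForms.

(** * The Bass-Serre tree of a Baumslag-Solitar group *)

Section BSTree.
Variables (m n : nat).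
Hypotheses (m_gt0 : 0 < m) (n_gt0 : 0 < n).
Local Notation a := (BS_a m n).
Local Notation t := (BS_t m n).
Local Notation A := (@BS_base m n).
Local Notation C := (@BS_edge_group m n).
Implicit Types (g h : BS m n).

Definition BS_tpow (b : bool) : BS m n := if b then t^-1%g else t.

Definition BS_nf g : nform := nf_word m n ([::], 0%R) (word_of g).

Lemma BS_nf1 : BS_nf 1%g = ([::], 0%R).
Proof.
rewrite -[RHS]/(nf_word m n ([::], 0%R) [::]); apply: nf_word_eq => //.
by apply/class_ofP; rewrite word_ofK.
Qed.

Lemma BS_nf_mulw g w : BS_nf (g * class_of (BS_rel m n) w)%g = nf_word m n (BS_nf g) w.
Proof.
rewrite /BS_nf -[RHS]foldl_cat -/(nf_word _ _ _ _); apply: nf_word_eq => //.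
by apply/class_ofP; rewrite word_ofK class_of_cat word_ofK.
Qed.

Lemma BS_nf_zpow g k : BS_nf (g * zpow a k)%g = ((BS_nf g).1, ((BS_nf g).2 + k)%R).
Proof.
have pos h (i : nat) : BS_nf (h * a ^+ i)%g = ((BS_nf h).1, ((BS_nf h).2 + i%:Z)%R).
  by rewrite -BS_class_nseq BS_nf_mulw nf_word_nseq.
case: k => i; first exact: pos.
have := pos (g * zpow a (Negz i))%g i.+1; rewrite -mulgA /= mulVg mulg1.
by case: (BS_nf _) (BS_nf _) => l k [l' k'] [-> ->] /=; congr pair; lia.
Qed.

Lemma BS_tpowE b : BS_tpow b = class_of (BS_rel m n) [:: (true, b)].
Proof. by case: b => //; rewrite /BS_tpow -[LHS]class_of_inv. Qed.

Lemma BS_nf_tpow g b : BS_nf (g * BS_tpow b)%g = nf_mult m n b (BS_nf g).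
Proof. by rewrite BS_tpowE BS_nf_mulw. Qed.

Lemma BS_zpow_tpow b k :
  (zpow a (k * modulus m n b)%R * BS_tpow b = BS_tpow b * zpow a (k * modulus m n (~~ b))%R)%g.
Proof.
have e : (t * zpow a (k * m%:Z)%R = zpow a (k * n%:Z)%R * t)%g.
  by rewrite -!zpow_expg -(BS_relation m n) -zpow_conj mulgVK.
case: b => /=; last by rewrite e.
by apply: (mulgI t); rewrite !mulgA e mulgK mulgV mul1g.
Qed.

Lemma BS_baseE x : A x <-> exists k, x = zpow a k.
Proof. exact: cyclic_subgroupE. Qed.

Lemma BS_edge_groupE x : C x <-> exists k, x = zpow a (k * n%:Z)%R.
Proof.
rewrite /BS_edge_group cyclic_subgroupE.
by split=> -[k ->]; exists k; rewrite zpow_expg.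
Qed.

Local Notation vtx := (coset A).
Local Notation T := (BS_tree m n).

(** The edges leaving [g A]. The coset [h C] joins [h A] to [h t A], so that it is
    traversed backwards from [g A] when [h = g t^-1]. *)
Definition BS_edge (b : bool) g : edge T := (coset C (if b then g * t^-1 else g)%g, b).

Lemma BS_src_edge b g : src (BS_edge b g) = vtx g.
Proof.
case: b => /=; last exact: hnn_origin_coset.
by rewrite /hnn_src /= hnn_target_coset mulgVK.
Qed.

Lemma BS_tgt_edge b g : tgt (BS_edge b g) = vtx (g * BS_tpow b)%g.
Proof.
case: b => /=; first exact: hnn_origin_coset.
by rewrite /hnn_tgt /= hnn_target_coset.
Qed.

Lemma BS_edge_surj (e : edge T) : exists b g, e = BS_edge b g.
Proof.
case: e => S b; have [g ->] := coset_surj S.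
by case: b; [exists true, (g * t)%g; rewrite /BS_edge mulgK|exists false, g].
Qed.

Lemma BS_vtx_eqP g h : vtx g = vtx h <-> exists k, h = (g * zpow a k)%g.
Proof.
rewrite coset_eqP; last exact: subgroup_cyclic.
rewrite BS_baseE; split=> -[k e]; exists k; last by rewrite e mulKg.
by rewrite -e mulgA mulgV mul1g.
Qed.

Lemma BS_edge_eqP g h : coset C g = coset C h <-> exists k, h = (g * zpow a (k * n%:Z)%R)%g.
Proof.
rewrite coset_eqP; last exact: subgroup_cyclic.
rewrite BS_edge_groupE; split=> -[k e]; exists k; last by rewrite e mulKg.
by rewrite -e mulgA mulgV mul1g.
Qed.

(** This is why only one edge leads down from a vertex: the vertex determines [g] up
    to a power of [a], and the edge leads down for a single residue of the
    exponent modulo [modulus b]. *)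
Lemma BS_edge_shift b g k : BS_edge b (g * zpow a (k * modulus m n b)%R)%g = BS_edge b g.
Proof.
congr pair; apply/esym/BS_edge_eqP; exists k; case: b => //.
by have /= := BS_zpow_tpow true k; rewrite -!mulgA => ->.
Qed.

Definition BS_depth (v : vert T) : nat :=
  size (BS_nf (sval (cid (coset_surj (v : coset_space A))))).1.

Lemma BS_depthE g : BS_depth (vtx g) = size (BS_nf g).1.
Proof.
rewrite /BS_depth; case: cid => h /= /esym/BS_vtx_eqP[k ->].
by rewrite BS_nf_zpow.
Qed.

Lemma BS_depth_tgt b g :
  size (BS_nf (g * BS_tpow b)%g).1 =
    if nf_cancels m n b (BS_nf g) then (size (BS_nf g).1).-1
    else (size (BS_nf g).1).+1.
Proof.
by rewrite BS_nf_tpow /nf_mult; case: ifP => //= _; rewrite size_behead.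
Qed.

Lemma nf_cancels_size b s : nf_cancels m n b s -> 0 < size s.1.
Proof. by case: s => -[|? ?] ?; rewrite /nf_cancels /= ?andbF. Qed.

Lemma BS_walk_from1 g : exists s, walk (vtx 1%g : vert T) s (vtx g).
Proof.
rewrite -[g]word_ofK; elim/last_ind: (word_of g) => [|w [x b] [s hs]].
  by exists [::].
rewrite -cats1 class_of_cat; case: x; last first.
  exists s; congr (walk _ _ _): hs; apply/BS_vtx_eqP.
  exists (if b then Negz 0 else 1%R); congr (_ * _)%g.
  by case: b => //=; rewrite expg1 -[RHS]class_of_inv.
exists (rcons s (BS_edge b (class_of _ w))); apply/walk_rcons.
by rewrite BS_src_edge BS_tgt_edge BS_tpowE.
Qed.

Lemma BS_is_tree : is_tree T.
Proof.
apply: (@depth_is_tree T BS_depth).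
- by exists (vtx 1%g).
- move=> x y; have [g ->] := coset_surj x; have [h ->] := coset_surj y.
  have [s hs] := BS_walk_from1 g; have [s' hs'] := BS_walk_from1 h.
  exists (rev_walk s ++ s'); apply/walk_cat.
  by exists (vtx 1%g : vert T) => //; exact: walk_rev.
- move=> e; have [b [g ->]] := BS_edge_surj e.
  rewrite BS_src_edge BS_tgt_edge !BS_depthE BS_depth_tgt.
  by case: ifP => [/nf_cancels_size|_]; lia.
move=> e e'; have [b [g ->]] := BS_edge_surj e; have [b' [g' ->]] := BS_edge_surj e'.
rewrite !BS_src_edge !BS_tgt_edge !BS_depthE !BS_depth_tgt => /BS_vtx_eqP[k ->].
rewrite BS_nf_zpow; case: (boolP (nf_cancels _ _ b _)) => [|_]; last by lia.
case: (boolP (nf_cancels _ _ b' _)) => [|_]; last by move=> /= *; lia.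
rewrite /nf_cancels /= => /andP[d' hd'] /andP[d hd] _ _.
have eb : b = b'.
  case: (BS_nf g).1 hd hd' => [|[r c] l] //= /eqP -> /eqP.
  exact: (can_inj negbK).
rewrite -{}eb in d' *.
have /dvdzP[q ->] : (modulus m n b %| k)%Z by rewrite -(rpredDr _ d) // addrC.
by rewrite BS_edge_shift.
Qed.

Lemma BS_without_inversions : without_inversions (BS_action m n).
Proof. by move=> g [S []]. Qed.

End BSTree.

(** * The element t a t^-1 a *)

Section BS23.
Local Notation a := (BS_a 2 3).
Local Notation t := (BS_t 2 3).
Local Notation C := (@BS_edge_group 2 3).
Local Notation T := (BS_tree 2 3).
Local Notation act := (BS_action 2 3).
Local Notation g := (t * a * t^-1 * a)%g.
Implicit Types (S U : coset_space C) (e : edge T).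

(** The edges leaving the vertex [h A] in the direction of [t] are [h C], [h a C] and
    [h a ^ 2 C], and the generator [h a h^-1] of its stabilizer permutes them
    cyclically; this is the successor relation of the cyclic order. *)
Definition BS_next S U : Prop :=
  exists h, S = coset C h /\ U = coset C (h * a)%g.

(** The flag of an edge holds when the edge is traversed against [t]: only a walk
    that arrives against [t] and leaves along [t] turns between two of the three
    edges above. *)
Definition BS_turn e1 e2 : int :=
  if e1.2 && ~~ e2.2 then (`[< BS_next e1.1 e2.1 >]%:Z - `[< BS_next e2.1 e1.1 >]%:Z)%R
  else 0%R.

Lemma BS_turn_rev e1 e2 : BS_turn (rev_edge e2) (rev_edge e1) = (- BS_turn e1 e2)%R.
Proof.
case: e1 e2 => S [] [U []]; rewrite /BS_turn /= ?oppr0 //.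
by rewrite opprB.
Qed.

Lemma BS_turn_le1 e1 e2 : (`|BS_turn e1 e2| <= 1)%R.
Proof. by rewrite /BS_turn; case: ifP => // _; do 2!case: asboolP. Qed.

Lemma BS_next_translate h S U : BS_next (translate h S) (translate h U) <-> BS_next S U.
Proof.
have imp k S' U' : BS_next S' U' -> BS_next (translate k S') (translate k U').
  by move=> [x [-> ->]]; exists (k * x)%g; rewrite !translate_coset mulgA.
split; last exact: imp.
have trK S' : translate h^-1%g (translate h S') = S'.
  by have [x ->] := coset_surj S'; rewrite !translate_coset mulKg.
by move/(imp h^-1%g); rewrite !trK.
Qed.

Lemma BS_turn_act h e1 e2 : BS_turn (acte act h e1) (acte act h e2) = BS_turn e1 e2.
Proof.
rewrite /BS_turn /=; case: ifP => // _.
by congr (_%:Z - _%:Z)%R; congr nat_of_bool; apply: asbool_equiv_eq; exact: BS_next_translate.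
Qed.

(** Otherwise [C], which has index 3 in [<a>], would contain [a ^ 2]. *)
Lemma BS_next_asym h : ~ BS_next (coset C (h * a)%g) (coset C h).
Proof.
move=> [x [/BS_edge_eqP[k ->] /BS_edge_eqP[l e]]].
have := congr1 (fun y => (BS_nf y).2) e.
have -> y : (y * a)%g = (y * zpow a 1%R)%g by rewrite /= expg1.
have -> y : (y * a)%g = (y * zpow a 1%R)%g by rewrite /= expg1.
by rewrite !BS_nf_zpow /=; lia.
Qed.

Let treeT : is_tree T := @BS_is_tree 2 3 isT isT.
Let v0 : vert T := coset (@BS_base 2 3) 1%g.
Let e0 : edge T := BS_edge false 1%g.
Let e1 : edge T := BS_edge true (t * a)%g.

(* The edges [e0] and [e1] form a period of the axis of [g]. *)
Let e0_walk : walk (src e0) [:: e0; e1] (actv act g (src e0)).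
Proof.
split=> //; split.
  rewrite /e0 /e1 BS_src_edge BS_tgt_edge; apply/esym/BS_vtx_eqP; exists 1%R; by rewrite mul1g /= expg1.
change (tgt e1 = actv act g (src e0)); rewrite /e0 /e1 BS_src_edge BS_tgt_edge.
rewrite [RHS](translate_coset _ g 1%g) mulg1; apply/BS_vtx_eqP.
by exists 1%R; rewrite /= expg1.
Qed.

Let acte_e0 : acte act g e0 = BS_edge false g.
Proof. by rewrite /= /hnn_acte /= translate_coset mulg1. Qed.

Let e0_reduced : reduced [:: e0; e1; acte act g e0].
Proof.
rewrite acte_e0; apply/reduced_cons; split=> [|s']; last first.
  move=> /(congr1 (fun s => (head e0 s).1)) /= /esym/BS_edge_eqP[k e].
  have {}e : (1 * BS_tpow 2 3 false * zpow a 1%R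
              = 1 * zpow a (k * 3%:Z)%R * BS_tpow 2 3 false)%g.
    by rewrite -e /= expg1 !mul1g mulgVK.
  have := congr1 (@BS_nf 2 3) e.
  rewrite BS_nf_zpow // !(@BS_nf_tpow 2 3) // BS_nf_zpow // BS_nf1 // /=.
  rewrite (@nf_mult_shift 2 3 isT isT false [::] 0%R k).
  by case; rewrite /modulus /=; lia.
apply/reduced_cons; split=> [|s']; first exact: reduced1.
move=> /(congr1 (fun s => (head e0 s).1)) /= /BS_edge_eqP[k e].
have := congr1 (fun y => (BS_nf y).2) e.
have := @BS_nf_zpow 2 3 isT isT (t * a * t^-1)%g 1%R; rewrite [zpow _ _]expg1 => ge.
by rewrite BS_nf_zpow // ge /=; lia.
Qed.

Let e0_turns : turns BS_turn (rcons [:: e0; e1] (acte act g e0)) = 1%R.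
Proof.
rewrite acte_e0 /= /BS_turn /=.
rewrite (asboolT (P := BS_next _ _)); last by exists (t * a * t^-1)%g.
by rewrite (asboolF (P := BS_next _ _)) //; exact: BS_next_asym.
Qed.

Lemma BS23_well_aligned : well_aligned act g.
Proof.
apply: (slope_well_aligned BS_turn_rev BS_turn_le1 (treeX := treeT) BS_turn_act
  (v := 1%R)) => //; first exact: BS_without_inversions.
by rewrite -e0_turns; apply: has_slope_axis => //;
   [exact: BS_turn_rev|exact: BS_turn_le1|exact: BS_turn_act].
Qed.

(** The count along the axis is exact for the targets of the translates of [e0];
    passing from [tgt e0] back to [v0] costs at most 3. *)
Lemma BS23_cl_lower k N : prod_comm k (g ^+ N)%g -> N <= 12 * k + 3.
Proof.
move=> /(turn_sum_prod_comm BS_turn_rev BS_turn_le1 treeT BS_turn_act v0).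
have := turn_sum_axis treeT BS_turn_act e0_walk e0_reduced N.
have := turn_sum_triangle BS_turn_rev BS_turn_le1 treeT v0
  (actv act (g ^+ N)%g v0) (actv act (g ^+ N)%g (tgt e0)).
rewrite turn_sum_act //; last exact: BS_turn_act.
have -> : turn_sum BS_turn treeT v0 (tgt e0) = 0%R.
  by apply: (@turn_sumE _ _ _ _ [:: e0]); [split=> //; exact: BS_src_edge|exact: reduced1].
by rewrite e0_turns BS_src_edge -/v0; lia.
Qed.

End BS23.

(** * Products of commutators *)

Section ProductsOfCommutators.
Variable G : groupType.
Implicit Types (g h x y u v : G).

Lemma prod_comm0 : prod_comm 0 (1%g : G).
Proof. by exists [::]; rewrite ?big_nil. Qed.

Lemma prod_comm1 x y : prod_comm 1 (x * y * x^-1 * y^-1)%g.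
Proof.
exists [:: (x^-1, y^-1)%g] => //.
by rewrite big_seq1 /= /commg /conjg !invgK !mulgA.
Qed.

Lemma prod_commM k l g h : prod_comm k g -> prod_comm l h -> prod_comm (k + l) (g * h)%g.
Proof. by move=> [s <- ->] [s' <- ->]; exists (s ++ s'); rewrite ?size_cat ?big_cat. Qed.

Lemma prod_commJ k g h : prod_comm k g -> prod_comm k (h * g * h^-1)%g.
Proof.
move=> [s <- ->]; exists [seq (p.1 ^ h^-1, p.2 ^ h^-1)%g | p <- s]; first by rewrite size_map.
rewrite big_map; elim: s => [|p s IH]; first by rewrite !big_nil mulg1 mulgV.
rewrite !big_cons -IH -conjRg /conjg invgK !mulgA.
by rewrite mulgVK.
Qed.

Lemma prod_commX k g r : prod_comm k g -> prod_comm (k * r) (g ^+ r)%g.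
Proof.
move=> h; elim: r => [|r IH]; first by rewrite muln0; exact: prod_comm0.
by rewrite mulnS expgS; exact: prod_commM.
Qed.

(** Both words have the same letters, the first one with a [v] further to the right
    and a [u] further to the left; one commutator pays for both moves. *)
Lemma swap_outer u v y :
  exists2 c, prod_comm 1 c & (u * v * y * v * u = c * (v * v * y * u * u))%g.
Proof.
exists ((u * v * y) * (v * u^-1) * (u * v * y)^-1 * (v * u^-1)^-1)%g.
  exact: prod_comm1.
by rewrite !invgM !invgK !mulgA !(mulgVK, mulgK).
Qed.

(** Each commutator turns two more alternating letters into squares: the words
    [v ^+ (2 * j + 1) * u * (v * u) ^+ k * u ^+ (2 * j) * (v * u) ^+ k] with
    [j + k = m] interpolate between the two sides. *)
Lemma odd_power_mul u v m :
  exists2 c, prod_comm m c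
    & ((v * u) ^+ (2 * m + 1) = c * (v ^+ (2 * m + 1) * u ^+ (2 * m + 1)))%g.
Proof.
have interp k j : exists2 c, prod_comm k c &
    (v ^+ (2 * j + 1) * u * (v * u) ^+ k * u ^+ (2 * j) * (v * u) ^+ k
     = c * (v ^+ (2 * (j + k) + 1) * u ^+ (2 * (j + k) + 1)))%g; last first.
  have [c hc e] := interp m 0; exists c => //.
  rewrite add0n muln0 expg0 expg1 mulg1 in e; rewrite -e.
  by rewrite -expgS -expgnDr; congr (_ ^+ _)%g; lia.
elim: k j => [|k IH] j.
  exists 1%g; first exact: prod_comm0.
  by rewrite addn0 expg0 !mulg1 mul1g -mulgA -expgS addn1.
have [c hc e] := IH j.+1.
have [d hd ed] := swap_outer u v (u * (v * u) ^+ k * u ^+ (2 * j))%g.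
exists (v ^+ (2 * j + 1) * d * (v ^+ (2 * j + 1))^-1 * c)%g.
  by rewrite -add1n; apply: prod_commM hc; exact: prod_commJ.
rewrite addSnnS in e; rewrite -(mulgA _ c) -e.
have -> : (v ^+ (2 * j.+1 + 1) = v ^+ (2 * j + 1) * v * v)%g.
  by rewrite -!expgSr; congr (_ ^+ _)%g; lia.
have -> : (u ^+ (2 * j.+1) = u ^+ (2 * j) * u * u)%g.
  by rewrite -!expgSr; congr (_ ^+ _)%g; lia.
rewrite !expgS; move: ed; rewrite !mulgA => ed.
set V := (v ^+ (2 * j + 1))%g.
transitivity (V * (u * v * u * (v * u) ^+ k * u ^+ (2 * j) * v * u) * (v * u) ^+ k)%g.
  by rewrite !mulgA.
by rewrite ed !mulgA mulgVK.
Qed.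

(** With [v := x] and [u := y * x^-1 * y^-1], the product [v ^+ N * u ^+ N] is the
    commutator of [x ^+ N] and [y]. *)
Lemma prod_comm_odd_power x y m :
  prod_comm (m + 1) ((x * y * x^-1 * y^-1) ^+ (2 * m + 1))%g.
Proof.
have [c hc e] := odd_power_mul (y * x^-1 * y^-1)%g x m.
rewrite !mulgA -(mulgA c) in e; rewrite e; apply: prod_commM => //.
set N := 2 * m + 1; have -> : ((y * x^-1 * y^-1) ^+ N = y * (x ^+ N)^-1 * y^-1)%g.
  by rewrite -expVgn; exact: esym (zpow_conj x^-1%g y N).
by rewrite !mulgA; exact: prod_comm1.
Qed.

(** Modulo the central element [a ^+ 3 = b ^+ 2], the group generated by [a] and
    [b] is a quotient of the modular group, whose commutator subgroup is freely
    generated by [b * a^-1 * b * a] and [b * a * b * a^-1]; [(b * a) ^+ 6] is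
    conjugate to the commutator of these two, the boundary of a once-punctured
    torus. *)
Lemma trefoil_power6 (a b : G) (x := (b * a^-1 * b * a)%g) (y := (b * a * b * a^-1)%g) :
    (b ^+ 2 = a ^+ 3)%g ->
  ((b * a^-1) * (b * a) ^+ 6 * (b * a^-1)^-1
   = a ^+ 15 * (x * y * x^-1 * y^-1))%g.
Proof.
move=> ba; rewrite (expgnA a 3 5) {}/x {}/y.
have [z za zb] : exists2 z, (z = a ^+ 3)%g & (z = b ^+ 2)%g by exists (a ^+ 3)%g.
rewrite -za; have [c cE] : exists c, c = z^-1%g by exists z^-1%g.
have az : (a * z = z * a)%g by rewrite za -expgS -expgSr.
have bz : (b * z = z * b)%g by rewrite zb -expgS -expgSr.
have ac : (a * c = c * a)%g by apply: (mulgI z); rewrite mulgA -az cE mulgK mulVKg.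
have bc : (b * c = c * b)%g by apply: (mulgI z); rewrite mulgA -bz cE mulgK mulVKg.
have ai : (a^-1 = c * a * a)%g.
  by apply: (mulIg a); rewrite mulVg -!mulgA -expg2 -expgS -za cE mulVg.
have bi : (b^-1 = c * b)%g.
  by apply: (mulIg b); rewrite mulVg -!mulgA -expg2 -zb cE mulVg.
(* All inverses are removed; then the central elements are moved to the left. *)
have raz p : (p * a * z = p * z * a)%g by rewrite -mulgA az mulgA.
have rbz p : (p * b * z = p * z * b)%g by rewrite -mulgA bz mulgA.
have rac p : (p * a * c = p * c * a)%g by rewrite -mulgA ac mulgA.
have rbc p : (p * b * c = p * c * b)%g by rewrite -mulgA bc mulgA.
have rzc p : (p * z * c = p)%g by rewrite cE mulgK.
have rcz p : (p * c * z = p)%g by rewrite cE mulgVK.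
have raaa p : (p * a * a * a = p * z)%g by rewrite za -!mulgA.
rewrite -[LHS]mul1g -[RHS]mul1g !invgM !invgK !expgS expg0 ai bi !mulg1 !mulgA.
by rewrite !(raz, rbz, rac, rbc, rzc, rcz, raaa).
Qed.

End ProductsOfCommutators.

(** * Stable commutator length of t a t^-1 a *)

Section BS23Scl.
Local Notation a := (BS_a 2 3).
Local Notation t := (BS_t 2 3).
Local Notation g := (t * a * t^-1 * a)%g.

Lemma BS23_conj_expg2 k : (t * a ^+ (2 * k) * t^-1 = a ^+ (3 * k))%g.
Proof.
rewrite !expgnA -(BS_relation 2 3).
exact: zpow_conj _ _ k.
Qed.

Lemma BS23_expg_prod_comm k : prod_comm 1 (a ^+ k)%g.
Proof.
have -> : (a ^+ k = t * a ^+ (2 * k) * t^-1 * (a ^+ (2 * k))^-1)%g.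
  by rewrite BS23_conj_expg2 -expgnFr; [congr (_ ^+ _)%g|]; lia.
exact: prod_comm1.
Qed.

Lemma BS23_prod_comm : prod_comm 2 g.
Proof.
have h := BS23_expg_prod_comm 1; rewrite expg1 in h.
exact: (@prod_commM _ 1 1 _ _ (prod_commJ t h) h).
Qed.

(** Up to conjugation, [g ^+ 6] is the product of [a ^+ 15], all of whose powers are
    single commutators, and of a commutator that commutes with [a ^+ 15]. *)
Lemma BS23_power6 m : prod_comm (m + 2) (g ^+ (6 * (2 * m + 1)))%g.
Proof.
set b := (t * a * t^-1)%g; set N := 2 * m + 1.
have ba : (b ^+ 2 = a ^+ 3)%g.
  have := BS23_conj_expg2 1; rewrite !muln1 => <-.
  exact: esym (zpow_conj a t 2).
have := trefoil_power6 ba; set w := (b * a^-1)%g; set c := (_ * _^-1 * _^-1)%g => e.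
have az : commute (a ^+ 15)%g c.
  have -> : (c = (a ^+ 15)^-1 * (w * (b * a) ^+ 6 * w^-1))%g by rewrite e mulKg.
  have za : commute (a ^+ 15)%g a by exact: commute_sym (commuteX _ (commute_refl _)).
  have zb : commute (a ^+ 15)%g b.
    by rewrite (expgnA a 3 5) -ba -expgnA; exact: commute_sym (commuteX _ (commute_refl _)).
  have zw : commute (a ^+ 15)%g w by apply: commuteM => //; exact: commuteV.
  apply: commuteM; first exact: commuteV (commute_refl _).
  apply: commuteM; last exact: commuteV.
  by apply: commuteM => //; apply/commuteX/commuteM.
have -> : (g ^+ (6 * N) = w^-1 * ((a ^+ 15) ^+ N * c ^+ N) * w^-1^-1)%g.
  rewrite -expgMn // -e invgK expgnA.
  have -> : ((w * (b * a) ^+ 6 * w^-1) ^+ N = w * ((b * a) ^+ 6) ^+ N * w^-1)%g.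
    exact: esym (zpow_conj _ _ N).
  by rewrite -(mulgA w) mulKg mulgVK.
apply: prod_commJ; rewrite -expgnA.
have -> : m + 2 = 1 + (m + 1) by lia.
by apply: prod_commM; [exact: BS23_expg_prod_comm|exact: prod_comm_odd_power].
Qed.

Lemma BS23_cl_upper N : exists2 k, prod_comm k (g ^+ N)%g & 12 * k <= N + 300.
Proof.
(* The constant 300 covers the remainder [r < 12], paid for with [2 * r]
   commutators, and the small exponents. *)
have [N6|N6] := ltnP N 6.
  by exists (2 * N); [exact/prod_commX/BS23_prod_comm|lia].
pose q := (N - 6) %/ 12; pose r := (N - 6) %% 12.
have eN : N - 6 = q * 12 + r by exact: divn_eq.
have r12 : r < 12 by rewrite ltn_mod.
exists ((q + 2) + 2 * r); last by lia.
have -> : (g ^+ N = g ^+ (6 * (2 * q + 1)) * g ^+ r)%g.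
  by rewrite -expgnDr; congr (_ ^+ _)%g; lia.
by apply: prod_commM; [exact: BS23_power6|exact/prod_commX/BS23_prod_comm].
Qed.

Lemma BS23_cl N : N <= 12 * cl (g ^+ N)%g + 3 /\ 12 * cl (g ^+ N)%g <= N + 300.
Proof.
have [k hk kN] := BS23_cl_upper N.
have [hc ck] := @least_spec (fun k => prod_comm k (g ^+ N)%g) k hk.
rewrite -/(cl _) in hc ck; split; first exact: BS23_cl_lower.
by lia.
Qed.

Lemma BS23_scl (R : realType) : scl R g = (1 / 12)%R%:E.
Proof.
have d1 : (0 < 1)%N /\ derived (g ^+ 1)%g.
  by split=> //; exists 2; rewrite expg1; exact: BS23_prod_comm.
rewrite /scl asboolT; last by exists 1%N; case: d1.
have [[k0 _] k1] := @least_spec (fun k => (0 < k)%N /\ derived (g ^+ k)%g) 1 d1.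
have -> : least (fun k => (0 < k)%N /\ derived (g ^+ k)%g) = 1%N by lia.
(* The quotients differ from 1/12 by at most [300 / (12 * N) = 25 / N]. *)
rewrite expg1 divr1; congr (_%:E); apply: cvg_lim; first exact: Rhausdorff.
apply/cvgrPdist_le => e e0; near=> N.
have N0 : (0 < N%:R :> R)%R by rewrite ltr0n; near: N; exact: nbhs_infty_gt.
have Ne : (25 / e <= N%:R)%R by near: N; exact: nbhs_infty_ger.
have [l u] := BS23_cl N.
have {}l : (N%:R <= 12 * (cl (g ^+ N)%g)%:R + 3 :> R)%R.
  by rewrite -natrM -natrD ler_nat.
have {}u : (12 * (cl (g ^+ N)%g)%:R <= N%:R + 300 :> R)%R.
  by rewrite -natrM -natrD ler_nat.
have -> : (1 / 12 - (cl (g ^+ N)%g)%:R / N%:R = (N%:R - 12 * (cl (g ^+ N)%g)%:R) / (12 * N%:R) :> R)%R.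
  by field; rewrite gt_eqF.
rewrite normrM normfV (gtr0_norm (x := 12 * _)%R) ?mulr_gt0 // ler_pdivrMr ?mulr_gt0 //.
rewrite ler_pdivrMr // in Ne.
by rewrite ler_norml; apply/andP; split; nra.
Unshelve. all: by end_near.
Qed.

End BS23Scl.

Theorem theorem6p10 (R : realType) :
  let a : BS 2 3 := BS_a 2 3 in
  let t : BS 2 3 := BS_t 2 3 in
  let g : BS 2 3 := (t * a * t^-1 * a)%g in
  [/\ is_tree (BS_tree 2 3) /\ without_inversions (BS_action 2 3),
      well_aligned (BS_action 2 3) g,
      scl R g = (1 / 12)%R%:E
    & forall c : R, (1 / 12 < c)%R ->
      ~ (forall (G : groupType) (X : graph) (act : graph_action G X),
           is_tree X -> without_inversions act ->
           forall h : G, well_aligned act h -> (c%:E <= scl R h)%E)].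
Proof.
have treeT := @BS_is_tree 2 3 isT isT.
have noinv := @BS_without_inversions 2 3.
split=> //; first exact: BS23_well_aligned.
  exact: BS23_scl.
move=> c ltc /(_ _ _ _ treeT noinv _ BS23_well_aligned).
by rewrite BS23_scl lee_fin leNgt ltc.
Qed.
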